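(* Let $d\geq 2$, $N\geq 1$, and let $X=(x^{(1)},\ldots,x^{(N)})\in\left(\mathbb{S}^{d-1}\right)^N$ be generic. Then \[ \Delta(X)=\max_{I\in\Phi}\max\big\{\mu^{emp}(X,w_I,t_I)-\mu^{cap}(t_I),\ \mu^{emp}(X,-w_I,-t_I)-\mu^{cap}(-t_I)\big\}. \]
   Context: $\mathbb{S}^{d-1}$ is the Euclidean unit sphere in $\mathbb{R}^d$, $\sigma$ the uniform probability measure on it. $H(w,t)=\{x\in\mathbb{R}^d\mid\langle w,x\rangle\geq t\}$. For $X\in(\mathbb{S}^{d-1})^N$, $\mu^{emp}(X,w,t)=N^{-1}\#\{i\mid x^{(i)}\in H(w,t)\}$; for $t\in[-1,1]$, $\mu^{cap}(t)=\sigma(\mathbb{S}^{d-1}\cap H(w,t))$ for any $w\in\mathbb{S}^{d-1}$. $\Delta(X)=\sup_{w\in\mathbb{S}^{d-1},t\in[-1,1]}|\mu^{emp}(X,w,t)-\mu^{cap}(t)|$. $X\in(\mathbb{R}^d)^N$ is generic if for every $I\subseteq\{1,\ldots,N\}$ with $\#I\leq d$ the vectors $\{x^{(i)}\mid i\in I\}$ are linearly independent. $\Phi=\{I\subseteq\{1,\ldots,N\}\mid 1\leq\#I\leq d\}$. For generic $X$ and $I\in\Phi$, $X_I$ is the matrix with columns $x^{(i)}$, $i\in I$, $\mathbf{1}=(1,\ldots,1)^\top\in\mathbb{R}^{\#I}$, $t_I=\left(\mathbf{1}^\top(X_I^\top X_I)^{-1}\mathbf{1}\right)^{-1/2}$ and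 $w_I=t_IX_I(X_I^\top X_I)^{-1}\mathbf{1}$. *)

(* Defs.v *)
From mathcomp Require Import all_boot all_order all_algebra.
From mathcomp Require Import all_classical all_reals all_analysis.

Set Implicit Arguments.
Unset Strict Implicit.
Unset Printing Implicit Defensive.

Import Order.TTheory GRing.Theory Num.Theory.
Import numFieldTopology.Exports numFieldNormedType.Exports.

Local Open Scope classical_set_scope.
Local Open Scope ring_scope.

Section Sphere.
Variables (R : realType) (d : nat).

Definition dot (x y : 'cV[R]_d) : R := \sum_(i < d) x i 0 * y i 0.

(* The library norm on matrices is the sup norm, hence a separate definition. *)
Definition enorm (x : 'cV[R]_d) : R := Num.sqrt (dot x x).

Definition sphere : set 'cV[R]_d := [set x | enorm x = 1].

Definition halfspace (w : 'cV[R]_d) (t : R) : set 'cV[R]_d :=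
  [set x | t <= dot w x].

(* R^d with its Borel sigma-algebra; the topology of the sup norm is the
   Euclidean one. *)
Definition borel : measurableType _ := g_sigma_algebraType (@open 'cV[R]_d).

(* The uniform probability measure on the sphere is the unique Borel probability
   carried by the sphere that is invariant under the orthogonal group. *)
Definition uniform_on_sphere (sigma : probability borel R) : Prop :=
  sigma sphere = 1%E /\
  forall (Q : 'M[R]_d) (A : set borel), Q^T *m Q = 1%:M -> measurable A ->
    sigma [set x : borel | A (Q *m x)] = sigma A.

(* [get sphere] is an arbitrary point of the sphere; [mu_capE] below shows that
   the value does not depend on this choice. *)
Definition mu_cap (sigma : probability borel R) (t : R) : R :=
  fine (sigma (sphere `&` halfspace (get sphere) t)).

End Sphere.

Arguments sphere : clear implicits.

Section Discrepancy.
Variables (R : realType) (d N : nat).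
Implicit Types (X : 'I_N -> 'cV[R]_d) (I : {set 'I_N}).

Definition mu_emp X (w : 'cV[R]_d) (t : R) : R :=
  N%:R^-1 * #|[set i | X i \in halfspace w t]%SET|%:R.

Definition Delta (sigma : probability (borel R d) R) X : R :=
  sup [set r | exists w t, [/\ sphere R d w, -1 <= t <= 1 &
                               r = `|mu_emp X w t - mu_cap sigma t|]].

(* Linear independence of the family indexed by I, so that in particular
   repeated points are excluded. *)
Definition generic X : Prop :=
  forall I, (#|I| <= d)%N -> free [seq X i | i in I].

Definition Phi : {set {set 'I_N}} := [set I : {set 'I_N} | (1 <= #|I| <= d)%N]%SET.

Definition XI X I : 'M[R]_(d, #|I|) := \matrix_(k, j) X (enum_val j) k 0.

Definition ones (n : nat) : 'cV[R]_n := const_mx 1.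

Definition gramV X I : 'M[R]_#|I| := invmx ((XI X I)^T *m XI X I).

Definition tI X I : R :=
  (Num.sqrt (((ones #|I|)^T *m gramV X I *m ones #|I|) 0 0))^-1.

Definition wI X I : 'cV[R]_d :=
  tI X I *: (XI X I *m gramV X I *m ones #|I|).

End Discrepancy.

Section WellDefined.
Variables (R : realType) (d : nat).
Implicit Types (x y w u v : 'cV[R]_d).

Lemma dotE x y : (x^T *m y) 0 0 = dot x y.
Proof. by rewrite mxE; apply: eq_bigr => i _; rewrite mxE. Qed.

Lemma dotC x y : dot x y = dot y x.
Proof. by apply: eq_bigr => i _; rewrite mulrC. Qed.

Lemma dotBr x y z : dot x (y - z) = dot x y - dot x z.
Proof. by rewrite -!dotE mulmxBr !mxE. Qed.

Lemma dotZr x (a : R) y : dot x (a *: y) = a * dot x y.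
Proof. by rewrite -!dotE -scalemxAr mxE. Qed.

Lemma dot_ge0 x : 0 <= dot x x.
Proof. by apply: sumr_ge0 => i _; rewrite -expr2 sqr_ge0. Qed.

Lemma dot_eq0 x : dot x x = 0 -> x = 0.
Proof.
move=> /eqP; rewrite psumr_eq0 => [/allP x0|i _]; last first.
  by rewrite -expr2 sqr_ge0.
apply/matrixP => i j; rewrite ord1 mxE; apply/eqP.
by have := x0 i (mem_index_enum _); rewrite /= mulf_eq0 orbb.
Qed.

Lemma sphereE x : sphere R d x <-> dot x x = 1.
Proof.
rewrite /sphere/= /enorm; split=> [h|->]; last by rewrite sqrtr1.
by rewrite -(sqr_sqrtr (dot_ge0 x)) h expr1n.
Qed.

Lemma orthogonal_dot (Q : 'M[R]_d) x y : Q^T *m Q = 1%:M ->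
  dot (Q *m x) (Q *m y) = dot x y.
Proof.
by move=> h; rewrite -!dotE trmx_mul mulmxA -(mulmxA x^T) h mulmx1.
Qed.

Lemma orthogonal_transitive u v : sphere R d u -> sphere R d v ->
  exists Q : 'M[R]_d, Q^T *m Q = 1%:M /\ Q *m u = v.
Proof.
move=> /sphereE u1 /sphereE v1.
have [<-|uv] := eqVneq u v.
  by exists 1%:M; rewrite tr_scalar_mx !mul1mx.
pose z := u - v; pose c := dot z z.
have c0 : c != 0.
  by apply: contra_neq uv => /dot_eq0 /eqP; rewrite subr_eq0 => /eqP.
have zz : z^T *m z = c%:M by rewrite [LHS]mx11_scalar dotE.
have cE : c = 2 * dot z u.
  rewrite /c /z dotBr !(dotC (u - v)) !dotBr u1 v1 (dotC v u).
  by rewrite opprB mulrBr mulr1 mulr_natl mulr2n opprD !addrA; congr (_ - _);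
    rewrite addrAC.
have PP : (z *m z^T) *m (z *m z^T) = c *: (z *m z^T).
  by rewrite mulmxA -(mulmxA z) zz mul_mx_scalar -scalemxAl.
exists (1%:M - (2 / c) *: (z *m z^T)); split.
  have -> : (1%:M - (2 / c) *: (z *m z^T))^T = 1%:M - (2 / c) *: (z *m z^T).
    apply/matrixP => i j; rewrite !mxE eq_sym; congr (_ - _ * _).
    by apply: eq_bigr => k _; rewrite !mxE mulrC.
  rewrite mulmxBl mul1mx mulmxBr mulmx1 -scalemxAl -scalemxAr PP !scalerA.
  rewrite -mulrA divfK // mulr_natr mulr2n scalerDl opprB.
  by rewrite addrK subrK.
rewrite mulmxBl mul1mx -scalemxAl -mulmxA [z^T *m u]mx11_scalar dotE.
rewrite mul_mx_scalar scalerA.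
suff -> : 2 / c * dot z u = 1 by rewrite scale1r /z opprB addrC subrK.
by rewrite mulrAC -cE divff.
Qed.

Lemma dot_continuous (f g : 'cV[R]_d -> 'cV[R]_d) :
  continuous f -> continuous g -> continuous (fun x => dot (f x) (g x)).
Proof.
move=> cf cg; apply: (@continuous_big R _ _ _ _ add_continuous) => i _ x.
have cc (h : 'cV[R]_d -> 'cV[R]_d) : continuous h ->
    {for x, continuous (fun y => h y i 0)}.
  move=> ch; apply: (@continuous_comp _ _ _ h (fun y : 'cV[R]_d => y i 0)).
    exact: ch.
  exact: coord_continuous.
exact: (@continuousM R _ (fun y => f y i 0) (fun y => g y i 0) x
  (cc f cf) (cc g cg)).
Qed.

Lemma measurable_closed (A : set (borel R d)) :
  closed (A : set 'cV[R]_d) -> measurable A.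
Proof.
move=> cA; rewrite -(setCK A); apply: measurableC.
by apply: sub_sigma_algebra; exact: closed_openC.
Qed.

Lemma measurable_cap w (t : R) :
  measurable (sphere R d `&` halfspace w t : set (borel R d)).
Proof.
apply: measurable_closed; apply: closedI.
  have -> : sphere R d = (fun x => dot x x) @^-1` [set 1].
    by apply/seteqP; split=> x /sphereE.
  apply: preimage_closed; last exact: closed_eq.
  by move=> x _; apply: dot_continuous => y; exact: cvg_id.
have -> : halfspace w t = (fun x => dot w x) @^-1` [set r | t <= r] by [].
apply: preimage_closed; last exact: closed_ge.
move=> x _; apply: (@dot_continuous (fun=> w) id).
  exact: cst_continuous.
by move=> y; exact: cvg_id.
Qed.

Lemma mu_capE (sigma : probability (borel R d) R) w (t : R) :
  uniform_on_sphere sigma -> sphere R d w ->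
  (mu_cap sigma t)%:E = sigma (sphere R d `&` halfspace w t).
Proof.
move=> [_ sQ] w1.
have g1 : sphere R d (get (sphere R d)) by exact: (getI w1).
rewrite /mu_cap fineK; last exact: fin_num_measure (measurable_cap _ _).
have [Q [QQ Qw]] := orthogonal_transitive w1 g1.
rewrite -(sQ Q _ QQ (measurable_cap _ _)); congr (sigma _).
apply/seteqP; split=> x [/sphereE x1 xw]; split; first [apply/sphereE|idtac].
- by rewrite -x1 orthogonal_dot.
- by move: xw; rewrite /halfspace /= -Qw orthogonal_dot.
- by rewrite orthogonal_dot.
- by rewrite /halfspace /= -Qw orthogonal_dot.
Qed.

End WellDefined.

(* Main.v *)
Require Import Defs.
From mathcomp Require Import all_boot all_order all_algebra.
From mathcomp Require Import all_classical all_reals all_analysis.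
From mathcomp Require Import ring lra.

Import Order.TTheory GRing.Theory Num.Theory.
Local Open Scope ring_scope.

(** Caps of complementary parameters satisfy
    [mu_cap t + mu_cap (- t) <= 1 <= mu_emp w t + mu_emp (- w) (- t)], so that
    [mu_cap - mu_emp] at [(w, t)] is at most [mu_emp - mu_cap] at [(- w, - t)]
    and only the excess [mu_emp - mu_cap] matters.  The first inequality needs
    that slices [dot w x = t] of the sphere are null: by invariance all slices
    of height [t] have the same measure, and along a suitable polynomial curve
    of directions no point lies on infinitely many of them.

    Given a cap containing a nonempty set [S] of points, move its bounding
    hyperplane, keeping [S] in the cap, never decreasing [t] (hence never
    increasing the measure of the cap), and keeping the points already on the
    hyperplane there, until a new point is reached.  After finitely many steps
    the normal lies in the span of the points [I] on the hyperplane, which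
    forces the cap to be given by [(wI, tI)] or [(- wI, - tI)]. *)

(** * Bilinearity of the dot product and normalization *)

Section DotProduct.
Context {R : realType} {d : nat}.
Implicit Types x y z u b : 'cV[R]_d.

Lemma dotDr x y z : dot x (y + z) = dot x y + dot x z.
Proof. by rewrite -!dotE mulmxDr mxE. Qed.

Lemma dotDl x y z : dot (x + y) z = dot x z + dot y z.
Proof. by rewrite !(dotC _ z) dotDr. Qed.

Lemma dotZl x (k : R) y : dot (k *: x) y = k * dot x y.
Proof. by rewrite !(dotC _ y) dotZr. Qed.

Lemma dotNl x y : dot (- x) y = - dot x y.
Proof. by rewrite -scaleN1r dotZl mulN1r. Qed.

Lemma dot0l x : dot 0 x = 0.
Proof. by rewrite -(scale0r x) dotZl mul0r. Qed.

Lemma dotNr x y : dot x (- y) = - dot x y.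
Proof. by rewrite dotC dotNl dotC. Qed.

Lemma dot_gt0 x : x != 0 -> 0 < dot x x.
Proof.
move=> x0; rewrite lt_neqAle dot_ge0 andbT eq_sym.
by apply: contra_neq x0; exact: dot_eq0.
Qed.

Lemma enorm_ge0 x : 0 <= enorm x. Proof. exact: sqrtr_ge0. Qed.

Lemma enorm_gt0 x : x != 0 -> 0 < enorm x.
Proof. by move=> /dot_gt0; rewrite sqrtr_gt0. Qed.

Lemma sqr_enorm x : enorm x ^+ 2 = dot x x.
Proof. by rewrite sqr_sqrtr // dot_ge0. Qed.

Lemma sphereN x : sphere R d x -> sphere R d (- x).
Proof. by rewrite !sphereE dotNl dotNr opprK. Qed.

Lemma sphere_dot_bound x y : sphere R d x -> sphere R d y ->
  -1 <= dot x y <= 1.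
Proof.
move=> /sphereE x1 /sphereE y1.
have := dot_ge0 (x - y); have := dot_ge0 (x + y).
by rewrite !(dotDl, dotDr, dotNl, dotNr) x1 y1 (dotC y x) => h1 h2; lra.
Qed.

Lemma unit_enorm x : x != 0 -> sphere R d ((enorm x)^-1 *: x).
Proof.
move=> x0; apply/sphereE; rewrite dotZl dotZr -sqr_enorm.
have := enorm_gt0 _ x0; move: (enorm x) => e e0; field; lra.
Qed.

End DotProduct.

(** * Gram matrices of free families *)

Section Hyperplane.
Context {R : realType} {d N : nat}.
Variable X : 'I_N -> 'cV[R]_d.
Implicit Types (I : {set 'I_N}) (b w : 'cV[R]_d).

(* [wI / tI]: the point of the span of the [X i], [i \in I], whose dot product
   with each of them is 1. *)
Definition apex I : 'cV[R]_d := XI X I *m gramV X I *m ones R #|I|.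

(** A kernel vector [v] gives [XI X I *m v^T] squared norm zero, hence a linear relation between the
    points of [I]. *)
Lemma gram_unit I : free [seq X i | i in I] ->
  (XI X I)^T *m XI X I \in unitmx.
Proof.
move=> fI; rewrite -row_free_unit -kermx_eq0; apply/rowV0P => v /sub_kermxP vG.
have Xv0 : XI X I *m v^T = 0.
  apply: dot_eq0; rewrite -dotE trmx_mul trmxK mulmxA -(mulmxA v) vG.
  by rewrite mul0mx mxE.
have /freeP h : free (image_tuple X (mem I)) by [].
apply/rowP => j; rewrite [RHS]mxE; apply: (h (v 0)).
rewrite -[RHS]Xv0; apply/matrixP => k l; rewrite ord1 summxE mxE.
by apply: eq_bigr => i _; rewrite !mxE nth_image mulrC.
Qed.

Lemma trXI_mul_eq0 I b : (forall i, i \in I -> dot (X i) b = 0) ->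
  (XI X I)^T *m b = 0.
Proof.
move=> hb; apply/matrixP => j k; rewrite ord1 [RHS]mxE -(hb _ (enum_valP j)).
by rewrite mxE; apply: eq_bigr => i _; rewrite !mxE.
Qed.

(** The Gram matrix has rank [d], so [XI X I] is row free and cancels from [b^T *m XI X I = 0]. *)
Lemma orthogonal_basis_eq0 I b : free [seq X i | i in I] -> #|I| = d ->
  (forall i, i \in I -> dot (X i) b = 0) -> b = 0.
Proof.
move=> /gram_unit/mxrank_unit rG cI /trXI_mul_eq0 Xb.
have fX : row_free (XI X I).
  rewrite /row_free eqn_leq rank_leq_row /=.
  rewrite -[X in (X <= _)%N]cI -[X in (X <= _)%N]rG.
  exact: mxrankM_maxr.
apply: trmx_inj; apply/eqP; rewrite trmx0 -(mulmx_free_eq0 _ fX).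
by rewrite -[X in _ *m X]trmxK -trmx_mul Xb trmx0.
Qed.

Lemma trXI_apex I : free [seq X i | i in I] ->
  (XI X I)^T *m apex I = ones R #|I|.
Proof. by move=> /gram_unit uG; rewrite /apex !mulmxA mulmxV // mul1mx. Qed.

Lemma dot_apex I i : free [seq X i | i in I] -> i \in I ->
  dot (apex I) (X i) = 1.
Proof.
move=> /trXI_apex/matrixP h iI; have := h (enum_rank_in iI i) 0.
rewrite !mxE => <-; rewrite dotC; apply: eq_bigr => k _.
by rewrite !mxE enum_rankK_in.
Qed.

Lemma dot_apex_orthogonal I b : (forall i, i \in I -> dot (X i) b = 0) ->
  dot (apex I) b = 0.
Proof.
move=> /trXI_mul_eq0 Xb.
by rewrite -dotE /apex -mulmxA trmx_mul -mulmxA Xb mulmx0 mxE.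
Qed.

Lemma dot_apex_apex I : free [seq X i | i in I] ->
  dot (apex I) (apex I) = ((ones R #|I|)^T *m gramV X I *m ones R #|I|) 0 0.
Proof.
move=> fI; rewrite -dotE {2}/apex -mulmxA mulmxA.
by rewrite -[X in _ *m X *m _]trmxK -trmx_mul trXI_apex // mulmxA.
Qed.

Lemma tIE I : free [seq X i | i in I] -> tI X I = (enorm (apex I))^-1.
Proof. by move=> fI; rewrite /tI -dot_apex_apex. Qed.

Lemma wIE I : wI X I = tI X I *: apex I.
Proof. by []. Qed.

Section NonEmpty.
Variable I : {set 'I_N}.
Hypotheses (fI : free [seq X i | i in I]) (I0 : (0 < #|I|)%N).

Lemma apex_neq0 : apex I != 0.
Proof.
have /card_gt0P [i iI] := I0; apply: contra_neq (@oner_neq0 R) => a0.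
by rewrite -(dot_apex I i fI iI) a0 dot0l.
Qed.

Lemma tI_gt0 : 0 < tI X I.
Proof. by rewrite tIE // invr_gt0 enorm_gt0 // apex_neq0. Qed.

Lemma sphere_wI : sphere R d (wI X I).
Proof. by rewrite wIE tIE //; apply: unit_enorm; exact: apex_neq0. Qed.

Lemma sqr_tI : tI X I ^+ 2 * dot (apex I) (apex I) = 1.
Proof. by move/sphereE: sphere_wI; rewrite wIE dotZl dotZr => <-; ring. Qed.

Lemma dot_wI i : i \in I -> dot (wI X I) (X i) = tI X I.
Proof. by move=> iI; rewrite wIE dotZl dot_apex // mulr1. Qed.

Lemma tI_bound : (forall i, sphere R d (X i)) -> -1 <= tI X I <= 1.
Proof.
move=> Xs; have /card_gt0P [i iI] := I0; rewrite -(dot_wI i) //.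
exact: sphere_dot_bound sphere_wI (Xs i).
Qed.

End NonEmpty.

(* The component of [w] orthogonal to the points of [I], when all of them lie
   on the hyperplane [dot w x = t]. *)
Lemma dot_resid I w (t : R) : free [seq X i | i in I] ->
  (forall i, i \in I -> dot w (X i) = t) ->
  forall i, i \in I -> dot (X i) (w - t *: apex I) = 0.
Proof.
move=> fI wt i iI; rewrite dotC dotDl dotNl dotZl dot_apex // wt //; ring.
Qed.

(** Pythagoras for the orthogonal sum of [(t + r) *: apex I] and [w - t *: apex I]. *)
Lemma enorm_resid I w (t r : R) : free [seq X i | i in I] ->
  (forall i, i \in I -> dot w (X i) = t) ->
  enorm (w + r *: apex I) ^+ 2 =
    (t + r) ^+ 2 * dot (apex I) (apex I) +
    dot (w - t *: apex I) (w - t *: apex I).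
Proof.
move=> fI wt; have := dot_apex_orthogonal _ _ (dot_resid I w t fI wt).
rewrite sqr_enorm !(dotDl, dotDr, dotNl, dotNr, dotZl, dotZr) (dotC w (apex I)).
move=> h; have {h} -> : dot (apex I) w = t * dot (apex I) (apex I).
  by apply/eqP; rewrite -subr_eq0 h.
ring.
Qed.

End Hyperplane.

(** * Moving a cap to an extreme one *)

Section ExtremeCap.
Context {R : realType} {d N : nat}.

(* [t / n] is nondecreasing in [t] when [n] is the norm of a vector with fixed
   component (of squared norm [B]) orthogonal to the direction of motion. *)
Lemma slope_mono (t0 t r A B n n' : R) :
  0 <= r -> 0 <= B -> 0 < n -> 0 <= n' ->
  n ^+ 2 = t ^+ 2 * A + B -> n' ^+ 2 = (t + r) ^+ 2 * A + B ->
  t0 * n <= t -> t0 * n' <= t + r.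
Proof.
move=> r0 B0 n0 n'0 nE n'E tn.
suff h : t * n' <= (t + r) * n.
  by rewrite -(ler_pM2r n0); apply: le_trans h; rewrite mulrAC ler_wpM2r.
(* After squaring, the terms in [A] cancel and the sides differ by [r * (2 * t + r) * B], of known
   sign when [t] and [t + r] have the same sign. *)
have rB (s : R) : 0 <= s -> 0 <= r * s * B by move=> s0; rewrite !mulr_ge0.
have [t_ge0|t_lt0] := leP 0 t.
  rewrite -ler_sqr ?nnegrE ?mulr_ge0 ?addr_ge0 ?(ltW n0) //.
  rewrite !exprMn nE n'E; have := rB (2 * t + r); nra.
have [tr_ge0|tr_lt0] := leP 0 (t + r).
  apply: (@le_trans _ _ 0); first by rewrite mulr_le0_ge0 // ltW.
  by rewrite mulr_ge0 // ltW.
rewrite -lerN2 -!mulNr -ler_sqr ?nnegrE ?mulr_ge0 ?oppr_ge0 ?(ltW n0)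
  ?(ltW t_lt0) ?(ltW tr_lt0) //.
rewrite !exprMn nE n'E; have := rB (- (2 * t + r)); nra.
Qed.

(** Used with [n = d], since genericity only controls families of at most [d] points. *)
Lemma subset_card_min (T : finType) (A : {set T}) n :
  exists I : {set T}, [/\ I \subset A, (#|I| <= n)%N & #|I| = n \/ I = A].
Proof.
have [/card_geqP[s [us sn sA]]|An] := leqP n #|A|; last first.
  by exists A; rewrite subxx ltnW //; split => //; right.
have cI : #|[set x in s]%SET| = n by rewrite cardsE (card_uniqP us).
exists [set x in s]%SET; split; last by left.
  by apply/fintype.subsetP => x; rewrite inE => /sA.
by rewrite cI.
Qed.

Variable X : 'I_N -> 'cV[R]_d.
Hypothesis X_generic : generic X.

Definition active (S : {set 'I_N}) (u : 'cV[R]_d) (t : R) : {set 'I_N} :=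
  [set i in S | dot u (X i) == t]%SET.

(** The normal [u] is not normalized: the true height is [t / enorm u], kept at least [t0].
    Induction on the number of inactive indices. *)
Lemma extreme_cap (S : {set 'I_N}) (t0 : R) (u : 'cV[R]_d) (t : R) :
  (0 < d)%N -> u != 0 -> (0 < #|active S u t|)%N ->
  (forall i, i \in S -> t <= dot u (X i)) -> t0 * enorm u <= t ->
  exists2 I, I \in Phi d N &
    (t0 <= tI X I /\ forall i, i \in S -> tI X I <= dot (wI X I) (X i)) \/
    (t0 <= - tI X I /\ forall i, i \in S -> - tI X I <= dot (- wI X I) (X i)).
Proof.
move=> d0; have [n] := ubnP (N - #|active S u t|)%N.
elim: n u t => // n IH u t cA u0 A0 uS ut.
have [I [IA Id cI]] := subset_card_min _ (active S u t) d.
have I0 : (0 < #|I|)%N by case: cI => ->.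
have fI : free [seq X i | i in I] by exact: X_generic.
have IPhi : I \in Phi d N by rewrite inE I0 Id.
have It i : i \in I -> dot u (X i) = t.
  by move=> /(fintype.subsetP IA); rewrite inE => /andP[_ /eqP].
have nE := enorm_resid X I u t _ fI It.
have bI := dot_resid X I u t fI It.
have T0 := tI_gt0 X I fI I0; have Ta := sqr_tI X I fI I0.
have n0 := enorm_gt0 u u0; have n2 := nE 0.
rewrite scale0r !addr0 in n2.
(* If the residue vanishes, the sign of [t] selects [(wI, tI)] or its opposite. *)
have [b0|b0] := eqVneq (u - t *: apex X I) 0.
  have uE : u = t *: apex X I by apply/eqP; rewrite -subr_eq0 b0.
  have Tn : tI X I * enorm u = `|t|.
    apply/eqP; rewrite -(@eqrXn2 _ 2) ?mulr_ge0 ?(ltW T0) ?(ltW n0) //.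
    rewrite exprMn n2 b0 -normrX ger0_norm ?sqr_ge0 //.
    by rewrite dot0l addr0 mulrCA Ta mulr1.
  have [t_gt0|t_lt0|t_eq0] := ltgtP 0 t; last first.
  - by move: u0; rewrite uE -t_eq0 scale0r eqxx.
  - exists I => //; right; split => [|i iS].
      rewrite ltr0_norm // in Tn; rewrite -(ler_pM2r n0) mulNr Tn opprK //.
    have := uS i iS; rewrite uE wIE dotNl !dotZl lerN2 => h.
    by rewrite ger_pMr // -(ler_nM2l t_lt0) mulr1.
  - exists I => //; left; split => [|i iS].
      by rewrite gtr0_norm // in Tn; rewrite -(ler_pM2r n0) Tn.
    have := uS i iS; rewrite uE wIE !dotZl => h.
    by rewrite ler_pMr // -(ler_pM2l t_gt0) mulr1.
(* A nonzero residue is orthogonal to all points of [I], which thus cannot number [d]. *)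
have {}cI : I = active S u t.
  case: cI => // cI; move: b0.
  by rewrite (orthogonal_basis_eq0 X I _ fI cI bI) eqxx.
have B0 := dot_gt0 _ b0.
have [/existsP[j0 Pj0]|/existsPn noj] :=
    boolP [exists j, (j \in S) && (dot (apex X I) (X j) < 1)]; last first.
  exists I => //; left; split => [|i iS]; last first.
    by rewrite wIE dotZl ler_pMr // leNgt; have := noj i; rewrite iS.
  have [t0_le0|t0_gt0] := leP t0 0; first exact: le_trans t0_le0 (ltW T0).
  have t_gt0 : 0 < t by apply: lt_le_trans ut; rewrite mulr_gt0.
  (* The component of [u] along [apex X I] has norm [t / tI X I], at most [enorm u]. *)
  rewrite -(ler_pM2r n0); apply: (le_trans ut).
  rewrite -ler_sqr ?nnegrE ?mulr_ge0 ?(ltW T0) ?(ltW n0) ?(ltW t_gt0) //.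
  rewrite exprMn n2 mulrDr mulrCA Ta mulr1 lerDl mulr_ge0 ?sqr_ge0 //.
  exact: ltW.
(* Along [u + r *: apex X I] at height [t + r], the points of [I] stay on the hyperplane, and
   [slack j] is the [r] at which it reaches [X j]. The least slack keeps [S] in the cap. *)
pose slack j := (dot u (X j) - t) / (1 - dot (apex X I) (X j)).
have [j /andP[jS ja] jmin] := @Order.TotalTheory.arg_minP _ _ _ j0
  (fun j => (j \in S) && (dot (apex X I) (X j) < 1)) slack Pj0.
have r0 : 0 <= slack j by rewrite divr_ge0 ?subr_ge0 ?uS // ltW.
have dotE' i : dot (u + slack j *: apex X I) (X i) =
    dot u (X i) + slack j * dot (apex X I) (X i) by rewrite dotDl dotZl.
have u'0 : u + slack j *: apex X I != 0.
  apply/eqP => u'0; have := nE (slack j); rewrite sqr_enorm u'0.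
  rewrite dot0l => /esym/eqP.
  rewrite paddr_eq0 ?(mulr_ge0 (sqr_ge0 _) (dot_ge0 _)) ?dot_ge0 // => /andP[_].
  by rewrite gt_eqF.
have jact : j \in active S (u + slack j *: apex X I) (t + slack j).
  rewrite inE jS dotE' /=; apply/eqP.
  have ? : 1 - dot (apex X I) (X j) != 0 by rewrite gt_eqF // subr_gt0.
  by rewrite /slack; field.
have jI : j \notin I.
  by apply/negP => jI; move: ja; rewrite dot_apex // ltxx.
have sub : I \subset active S (u + slack j *: apex X I) (t + slack j).
  apply/fintype.subsetP => i iI; have := iI; rewrite {1}cI inE => /andP[iS _].
  by rewrite inE iS dotE' It // dot_apex // mulr1 /=.
have lt : (#|I| < #|active S (u + slack j *: apex X I) (t + slack j)|)%N.
  by apply: proper_card; apply/properP; split => //; exists j.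
apply: (IH (u + slack j *: apex X I) (t + slack j)) => //.
- have := max_card (mem (active S (u + slack j *: apex X I) (t + slack j))).
  rewrite card_ord => h; rewrite ltnS in cA; apply: leq_trans cA.
  by rewrite -cI ltn_sub2l // (leq_trans lt h).
- exact: leq_ltn_trans lt.
- move=> i iS; rewrite dotE'.
  have [ia|ia] := leP 1 (dot (apex X I) (X i)).
    have := uS i iS; nra.
  have := jmin i; rewrite iS ia => /(_ isT).
  rewrite [in X in _ <= X]/slack ler_pdivlMr ?subr_gt0 //; lra.
- exact: (slope_mono _ _ _ _ _ _ _ r0 (ltW B0) n0 (enorm_ge0 _) n2 (nE _) ut).
Qed.

End ExtremeCap.

(** * A polynomial curve of directions *)

Section NullSlice.
Context {R : realType}.

Lemma poly_inf_roots (p : {poly R}) :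
  (forall n, exists2 k, (n <= k)%N & root p k%:R) -> p = 0.
Proof.
move=> h; apply/eqP/negPn/negP => p0.
have [s [us ss rs]] : exists s : seq nat, [/\ uniq s, size s = size p &
    all (fun k => root p k%:R) s].
  elim: (size p) => [|m [s [us sm rs]]]; first by exists [::].
  (* A root beyond the maximum of [s] is new. *)
  have [k kn rk] := h (\max_(i <- s) i).+1.
  exists (k :: s); rewrite /= sm rk; split => //.
  rewrite us andbT; apply/negP => ks; move: kn.
  by rewrite ltnNge (leq_bigmax_seq k).
have := max_poly_roots p0 (rs := [seq k%:R | k <- s]).
rewrite size_map ss ltnn all_map => /(_ rs) h'.
by have := h' (etrans (map_inj_uniq (mulrIn (oner_neq0 R)) _) us).
Qed.

(* Skipping the exponent 2 makes the squared norm of the curve, as a polynomial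
   in its parameter, differ from the square of any combination of the
   coordinates. *)
Definition gap_exp (i : nat) : nat := (i + (1 < i))%N.

Lemma gap_exp_inj : injective gap_exp.
Proof.
by case=> [|[|i]] [|[|j]]; rewrite /gap_exp /= ?addn0 ?addn1 // => -[->].
Qed.

Definition gap_curve d (k : nat) : 'cV[R]_d := \col_i k%:R ^+ gap_exp i.

Lemma gap_curve_neq0 d k : (0 < d)%N -> gap_curve d k != 0.
Proof.
case: d => // d _; apply/eqP => /matrixP /(_ 0 0); rewrite !mxE expr0 => /eqP.
by rewrite oner_eq0.
Qed.

Definition gap_poly d (x : 'cV[R]_d) : {poly R} :=
  \sum_i x i 0 *: 'X^(gap_exp i).

Definition gap_norm d : {poly R} := \sum_(i < d) 'X^(gap_exp i) ^+ 2.

Lemma horner_gap_poly d (x : 'cV[R]_d) k :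
  (gap_poly d x).[k%:R] = dot (gap_curve d k) x.
Proof.
rewrite /gap_poly horner_sum; apply: eq_bigr => i _.
by rewrite !hornerE mxE mulrC.
Qed.

Lemma horner_gap_norm d k :
  (gap_norm d).[k%:R] = dot (gap_curve d k) (gap_curve d k).
Proof.
rewrite /gap_norm horner_sum; apply: eq_bigr => i _.
by rewrite !hornerE mxE.
Qed.

Lemma coef_gap_poly d (x : 'cV[R]_d) (i : 'I_d) :
  (gap_poly d x)`_(gap_exp i) = x i 0.
Proof.
rewrite /gap_poly coef_sum (bigD1 i) //= coefZ coefXn eqxx mulr1.
rewrite big1 ?addr0 // => j ji; rewrite coefZ coefXn (inj_eq gap_exp_inj).
by rewrite eq_sym (inj_eq val_inj) (negPf ji) mulr0.
Qed.

Lemma coef2_gap_poly d (x : 'cV[R]_d) : (gap_poly d x)`_2 = 0.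
Proof.
rewrite /gap_poly coef_sum big1 // => -[[|[|j]] hj] _; rewrite coefZ coefXn //=;
  by rewrite ?mulr0 // /gap_exp /= addn1 mulr0.
Qed.

Lemma coef_gap_norm d i :
  (gap_norm d)`_i = \sum_(j < d) (i == gap_exp j * 2)%N%:R.
Proof.
by rewrite /gap_norm coef_sum; apply: eq_bigr => j _; rewrite -exprM coefXn.
Qed.

(** With [a = x 0 0] and [b = x 1 0], equality in degrees 0, 1, 2 reads [a^2 = t^2], [2ab = 0],
    [b^2 = t^2]. Hence [t = 0], and then [gap_poly _ x = 0]. *)
Lemma gap_poly_sqr_neq n (x : 'cV[R]_n.+2) (t : R) : x != 0 ->
  gap_poly _ x ^+ 2 - t ^+ 2 *: gap_norm n.+2 != 0.
Proof.
apply: contra_neq => /eqP; rewrite subr_eq0 => /eqP pE.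
have c0 := congr1 (fun q : {poly R} => q`_0) pE.
have c1 := congr1 (fun q : {poly R} => q`_1) pE.
have c2 := congr1 (fun q : {poly R} => q`_2) pE.
have p0 : (gap_poly _ x)`_0 = x 0 0 by rewrite -(coef_gap_poly _ x 0).
have p1 : (gap_poly _ x)`_1 = x 1 0 by rewrite -(coef_gap_poly _ x 1).
have g0 : (gap_norm n.+2)`_0 = 1.
  by rewrite coef_gap_norm !big_ord_recl big1 ?addr0.
have g1 : (gap_norm n.+2)`_1 = 0.
  rewrite coef_gap_norm big1 // => i _.
  by case: eqP => // /(congr1 odd); rewrite oddM andbF.
have g2 : (gap_norm n.+2)`_2 = 1.
  by rewrite coef_gap_norm !big_ord_recl big1 ?addr0 ?add0r.
move: c0 c1 c2; rewrite !coefZ g0 g1 g2 expr2 !coefM !big_ord_recr !big_ord0 /=.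
rewrite !add0r !subn0 !subnn p0 p1 coef2_gap_poly => c0 c1 c2.
have t0 : t = 0.
  have h : (t ^+ 2) ^+ 2 = 0.
    transitivity ((x 0 0 * x 0 0) * (x 1 0 * x 1 0)); first by nra.
    have : x 0 0 * x 1 0 = 0 by nra.
    by move=> e; transitivity ((x 0 0 * x 1 0) ^+ 2); [ring|rewrite e expr0n].
  by move/eqP: h; rewrite !sqrf_eq0 => /eqP.
move/eqP: pE; rewrite t0 expr0n scale0r sqrf_eq0 => /eqP pE.
by apply/matrixP => i j; rewrite ord1 -coef_gap_poly pE coef0 mxE.
Qed.

End NullSlice.

(** * Slices are null; measures of opposite caps *)

Section Caps.
Context {R : realType} {d : nat}.
Variable sigma : probability (borel R d) R.
Hypotheses (d_ge2 : (2 <= d)%N) (sigma_uniform : uniform_on_sphere sigma).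

Definition cap (w : 'cV[R]_d) (t : R) : set (borel R d) :=
  (sphere R d `&` halfspace w t)%classic.

Definition slice (w : 'cV[R]_d) (t : R) : set (borel R d) :=
  (cap w t `&` cap (- w) (- t))%classic.

Lemma measurable_slice w t : measurable (slice w t).
Proof. by apply: measurableI; exact: measurable_cap. Qed.

Lemma sliceP w t x : slice w t x <-> sphere R d x /\ dot w x = t.
Proof.
rewrite /slice /cap /halfspace /= dotNl lerN2; split.
  by move=> [[xs h1] [_ h2]]; split => //; apply/le_anti/andP.
by move=> [xs ->].
Qed.

Lemma slice_invariant w v t : sphere R d w -> sphere R d v ->
  sigma (slice w t) = sigma (slice v t).
Proof.
move=> ws vs; have [Q [QQ Qw]] := orthogonal_transitive ws vs.
have [_ sQ] := sigma_uniform.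
rewrite -(sQ Q _ QQ (measurable_slice v t)); congr (sigma _).
apply/seteqP; split => x /sliceP [xs xt]; apply/sliceP.
  split; last by rewrite -Qw orthogonal_dot.
  by apply/sphereE; rewrite orthogonal_dot //; exact/sphereE.
split; last by rewrite -xt -Qw orthogonal_dot.
by move/sphereE: xs; rewrite orthogonal_dot // => /sphereE.
Qed.

Definition curve_slices (t : R) (n : nat) : set (borel R d) :=
  (\bigcup_(k in [set k | (n <= k)%N])
    slice ((enorm (gap_curve d k))^-1 *: gap_curve d k) t)%classic.

Lemma measurable_curve_slices t n : measurable (curve_slices t n).
Proof. by apply: bigcup_measurable => k _; exact: measurable_slice. Qed.

(** A common point lies on slices of arbitrarily large index [k]; squaring the slice equation makes
    each such [k] a root of the nonzero [q]. *)
Lemma bigcap_curve_slices t : (\bigcap_n curve_slices t n)%classic = set0.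
Proof.
apply/seteqP; split => // x hx.
have xs : sphere R d x by have [k _ /sliceP []] := hx 0 I.
have x0 : (x : 'cV[R]_d) != 0.
  by apply/eqP => x0; move/sphereE: xs; rewrite x0 dot0l => /eqP;
    rewrite eq_sym oner_eq0.
pose q : {poly R} := gap_poly d x ^+ 2 - t ^+ 2 *: gap_norm d.
have q0 : q != 0.
  rewrite /q; move: (x : 'cV[R]_d) x0; case: (d) d_ge2 => [|[|n]] // _ y y0.
  exact: gap_poly_sqr_neq.
move/eqP: q0; apply; apply: poly_inf_roots => n.
have [k nk /sliceP [_ kt]] := hx n I; exists k => //.
have c0 : 0 < enorm (gap_curve (R := R) d k).
  by rewrite enorm_gt0 // gap_curve_neq0 // ltnW.
rewrite /root /q !hornerE horner_gap_poly horner_gap_norm -sqr_enorm.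
by move: kt; rewrite dotZl => <-; apply/eqP; field; rewrite gt_eqF.
Qed.

(** By invariance each tail has at least the measure of the slice, while continuity from above sends
    the measures of the tails to 0. *)
Lemma slice_null w t : sphere R d w -> sigma (slice w t) = 0%E.
Proof.
move=> ws; apply/eqP; rewrite eq_le measure_ge0 andbT.
have -> : 0%E = sigma (\bigcap_n curve_slices t n)%classic.
  by rewrite bigcap_curve_slices measure0.
apply: (@cvge_ge _ \oo%classic _ _ (sigma \o curve_slices t)); last first.
  apply: nonincreasing_cvg_mu.
  - apply: le_lt_trans (probability_le1 _ (measurable_curve_slices t 0)) _.
    exact: ltry.
  - exact: measurable_curve_slices.
  - by rewrite bigcap_curve_slices.
  - move=> n m nm; apply/subsetPset => x [k /= mk kx]; exists k => //=.
    exact: leq_trans nm mk.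
apply: nearW => n /=.
rewrite (slice_invariant _ _ _ ws
  (unit_enorm _ (gap_curve_neq0 d n (ltnW d_ge2)))).
apply: le_measure; rewrite ?inE; [exact: measurable_slice|
  exact: measurable_curve_slices|].
by move=> x hx; exists n => /=.
Qed.

(** The two caps overlap in a null slice, so the sum is the measure of their union. *)
Lemma mu_cap_opp_le1 w t : sphere R d w ->
  mu_cap sigma t + mu_cap sigma (- t) <= 1.
Proof.
move=> ws; rewrite -lee_fin EFinD (mu_capE _ sigma_uniform ws).
rewrite (mu_capE _ sigma_uniform (sphereN _ ws)).
have mA := measurable_cap w t; have mB := measurable_cap (- w) (- t).
have BA0 : sigma (cap (- w) (- t) `&` cap w t)%classic = 0%E.
  by rewrite -(slice_null w t ws) /slice (setIC (cap w t)).
rewrite [X in (_ + X)%E](measureDI sigma mB mA).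
rewrite [X in (_ + (_ + X))%E]BA0 adde0.
rewrite -measureU //; last by rewrite setDIK.
  by apply: probability_le1; apply: measurableU => //; exact: measurableD.
exact: measurableD.
Qed.

Lemma mu_cap_le w t s : sphere R d w -> t <= s ->
  mu_cap sigma s <= mu_cap sigma t.
Proof.
move=> ws ts; rewrite -lee_fin !(mu_capE _ sigma_uniform ws).
apply: le_measure; rewrite ?inE; [exact: measurable_cap..|].
by move=> x [xs xt]; split => //; exact: le_trans xt.
Qed.

End Caps.

(** * Counting points in caps *)

Section Empirical.
Context {R : realType} {d N : nat}.
Variable X : 'I_N -> 'cV[R]_d.

Definition cap_points w t : {set 'I_N} :=
  [set i | X i \in halfspace w t]%SET.

Lemma mem_cap_points w t i : (i \in cap_points w t) = (t <= dot w (X i)).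
Proof. by rewrite inE; apply/idP/idP => [/set_mem|/mem_set]. Qed.

Lemma mu_emp_le w t v s : cap_points w t \subset cap_points v s ->
  mu_emp X w t <= mu_emp X v s.
Proof.
by move=> /subset_leq_card h; rewrite ler_wpM2l ?invr_ge0 ?ler0n // ler_nat.
Qed.

(** Opposite closed caps together contain every point. *)
Lemma mu_emp_opp_ge1 w t : (0 < N)%N ->
  1 <= mu_emp X w t + mu_emp X (- w) (- t).
Proof.
move=> N0; rewrite -mulrDr -natrD ler_pdivlMl ?ltr0n // mulr1 ler_nat.
rewrite -[X in (X <= _)%N]card_ord -cardsT.
have -> : [set: 'I_N]%SET = cap_points w t :|: cap_points (- w) (- t).
  apply/setP => i; rewrite finset.in_setU !mem_cap_points dotNl lerN2 le_total.
  by rewrite inE.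
exact: leq_card_setU.
Qed.

End Empirical.

(** * Reduction of the supremum to extreme caps *)

Section Discrepancy.
Context {R : realType} {d N : nat}.
Variables (sigma : probability (borel R d) R) (X : 'I_N -> 'cV[R]_d).
Hypotheses (d_ge2 : (2 <= d)%N) (N_ge1 : (1 <= N)%N).
Hypotheses (sigma_uniform : uniform_on_sphere sigma) (X_generic : generic X).

Definition excess (w : 'cV[R]_d) (t : R) : R := mu_emp X w t - mu_cap sigma t.

Definition extreme_excess (I : {set 'I_N}) : R :=
  Num.max (excess (wI X I) (tI X I)) (excess (- wI X I) (- tI X I)).

Lemma excess_opp_ge0 w t : sphere R d w ->
  0 <= excess w t + excess (- w) (- t).
Proof.
move=> ws; have := mu_emp_opp_ge1 X w t N_ge1.
have := mu_cap_opp_le1 sigma d_ge2 sigma_uniform w t ws.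
rewrite /excess; lra.
Qed.

Lemma excess_abs w t : sphere R d w ->
  `|excess w t| <= Num.max (excess w t) (excess (- w) (- t)).
Proof.
move=> /(excess_opp_ge0 w t) h; rewrite le_max.
by have [_|_] := ger0P (excess w t); apply/orP; [left|right; lra].
Qed.

Lemma excess_le w t v s : sphere R d w -> t <= s ->
  cap_points X w t \subset cap_points X v s -> excess w t <= excess v s.
Proof.
move=> ws ts /mu_emp_le h; rewrite lerB //.
exact: (mu_cap_le sigma sigma_uniform w).
Qed.

Lemma Phi_singleton : exists I, I \in Phi d N.
Proof.
exists [set Ordinal N_ge1]%SET; rewrite inE cards1 /=.
exact: ltnW.
Qed.

Lemma Phi_free I : I \in Phi d N -> free [seq X i | i in I].
Proof. by rewrite inE => /andP[_ /X_generic]. Qed.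

Lemma Phi_sphere I : I \in Phi d N -> sphere R d (wI X I).
Proof.
move=> IP; apply: sphere_wI; first exact: Phi_free.
by move: IP; rewrite inE => /andP[].
Qed.

Lemma excess_dominated w t : sphere R d w ->
  exists2 I, I \in Phi d N & excess w t <= extreme_excess I.
Proof.
(* An empty cap has excess at most 0, whereas two opposite excesses have a nonnegative maximum. *)
move=> ws; have [S0|/set0Pn[i0 i0S]] := eqVneq (cap_points X w t) finset.set0.
  have [I IP] := Phi_singleton; exists I => //; apply: (@le_trans _ _ 0).
    rewrite /excess /mu_emp -/(cap_points X w t) S0 cards0 mulr0 sub0r oppr_le0.
    by rewrite fine_ge0.
  have := excess_opp_ge0 _ (tI X I) (Phi_sphere I IP).
  by rewrite /extreme_excess le_max => h; case: lerP => //= ?; lra.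
(* Raising the height to the lowest point of the cap makes the active set nonempty. *)
have [j jS jmin] := @Order.TotalTheory.arg_minP _ _ _ i0
  (fun j => j \in cap_points X w t) (fun j => dot w (X j)) i0S.
have w0 : w != 0.
  apply/eqP => w0; move/sphereE: ws; rewrite w0 dot0l => /eqP.
  by rewrite eq_sym oner_eq0.
have [|||||I IP hI] :=
    extreme_cap X X_generic (cap_points X w t) t w (dot w (X j)).
- exact: ltnW.
- exact: w0.
- by apply/card_gt0P; exists j; rewrite inE jS /=.
- exact: jmin.
- by rewrite ws mulr1 -mem_cap_points.
exists I => //; rewrite /extreme_excess le_max; apply/orP.
by case: hI => -[tT hT]; [left|right]; apply: excess_le => //;
  apply/fintype.subsetP => i /hT; rewrite mem_cap_points.
Qed.

End Discrepancy.

Theorem theorem2 (R : realType) (d N : nat)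
    (sigma : probability (borel R d) R) (X : 'I_N -> 'cV[R]_d)
    (d_ge2 : (2 <= d)%N) (N_ge1 : (1 <= N)%N)
    (sigma_uniform : uniform_on_sphere sigma)
    (X_sphere : forall i, sphere R d (X i))
    (X_generic : generic X) :
  (Delta sigma X)%:E =
  \big[Order.max/-oo%E]_(I in Phi d N)
    (Num.max (mu_emp X (wI X I) (tI X I) - mu_cap sigma (tI X I))
             (mu_emp X (- wI X I) (- tI X I) - mu_cap sigma (- tI X I)))%:E.
Proof.
have [I0 I0P] := @Phi_singleton d N d_ge2 N_ge1.
have [I IP Imax] := @Order.TotalTheory.arg_maxP _ _ _ I0
  (fun I => I \in Phi d N) (extreme_excess sigma X) I0P.
(* As [I] lies in [Phi d N], the big maximum with default [-oo] is the value at the maximizer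
   [I]. *)
transitivity (extreme_excess sigma X I)%:E; last first.
  apply/le_anti/andP; split.
    exact: (@le_bigmax_cond _ _ _ _ I (fun I => I \in Phi d N)
      (fun I => (extreme_excess sigma X I)%:E)).
  by apply: bigmax_le => [|J JP]; rewrite ?leNye // lee_fin; exact: Imax.
have dom w t : sphere R d w -> excess sigma X w t <= extreme_excess sigma X I.
  move=> ws; have [J JP hJ] :=
    excess_dominated sigma X d_ge2 N_ge1 sigma_uniform X_generic w t ws.
  exact: le_trans hJ (Imax J JP).
congr EFin; rewrite /Delta; set E := (X in sup X).
have ubE : ubound E (extreme_excess sigma X I).
  move=> _ [w [t [ws _ ->]]].
  apply: le_trans (excess_abs sigma X d_ge2 N_ge1 sigma_uniform w t ws) _.
  by rewrite ge_max !dom //; exact: sphereN.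
have mem w t : sphere R d w -> -1 <= t <= 1 -> excess sigma X w t <= sup E.
  move=> ws tb; apply: le_trans (ler_norm _) _; apply: ub_le_sup.
    by exists (extreme_excess sigma X I).
  by exists w, t.
have ws := Phi_sphere X X_generic I IP.
have tb : -1 <= tI X I <= 1.
  apply: tI_bound => //; first exact: (Phi_free X X_generic).
  by move: IP; rewrite inE => /andP[].
(* The upper bound needs a member of the set, as [sup] does; the lower bound holds because both
   extreme parameter pairs are admissible. *)
apply/le_anti/andP; split.
  apply: ge_sup => //; exists `|excess sigma X (wI X I) (tI X I)|.
  by exists (wI X I), (tI X I).
rewrite /extreme_excess ge_max !mem //; first exact: sphereN.
by rewrite lerN2 lerNl andbC.
Qed.
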